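(* Let $K\in\mathbb{N}$, let $C$ be a random variable taking values in $\{1,\dots,K\}$, and let $\pi_k=\mathrm{P}(C=k)$. For each $k\in\{1,\dots,K\}$ let $F_k$ be a distribution function on $\mathbb{R}$ with $F_k\in D(G_{\xi_k})$ for some $\xi_k\in\mathbb{R}$, with normalizing sequences $a_{k,n}>0$ and $b_{k,n}\in\mathbb{R}$, and suppose that, for every $n$, conditionally on $C=k$, the random variables $X_{k,1},\dots,X_{k,n}$ are independent and identically distributed with distribution function $F_k$. Let $M_{k,n}=\max\{X_{k,1},\dots,X_{k,n}\}$ and define $$M_n=\sum_{k=1}^K I(C=k)\,M_{k,n},\qquad A_n=\sum_{k=1}^K I(C=k)\,a_{k,n},\qquad B_n=\sum_{k=1}^K I(C=k)\,b_{k,n}.$$ Then, for every $z\in\mathbb{R}$, $$\lim_{n\to\infty}\mathrm{P}\left(\frac{M_n-B_n}{A_n}\le z\right)=\sum_{k=1}^K\pi_k\,G_{\xi_k}(z).$$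
   Context: $I(\cdot)$ denotes the indicator function. For $\xi\in\mathbb{R}$, the extreme value distribution function $G_\xi$ is $G_\xi(z)=\exp\{-(1+\xi z)^{-1/\xi}\}$ when $1+\xi z>0$, interpreted for $\xi=0$ as $G_0(z)=\exp\{-e^{-z}\}$; when $1+\xi z\le 0$, $G_\xi(z)=0$ if $\xi>0$ and $G_\xi(z)=1$ if $\xi<0$. A distribution function $F$ belongs to the maximum domain of attraction of $G_\xi$, written $F\in D(G_\xi)$, with normalizing sequences $a_n>0$ and $b_n\in\mathbb{R}$, if for $Y_1,\dots,Y_n$ independent with distribution function $F$, $\lim_{n\to\infty}\mathrm{P}\big((\max\{Y_1,\dots,Y_n\}-b_n)/a_n\le z\big)=G_\xi(z)$ for every $z\in\mathbb{R}$. *)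

(* Defs.v *)
From mathcomp Require Import all_boot all_order all_algebra.
From mathcomp Require Import all_classical all_reals all_analysis.

Set Implicit Arguments.
Unset Strict Implicit.
Unset Printing Implicit Defensive.

Import Order.TTheory GRing.Theory Num.Theory.
Import numFieldNormedType.Exports.

Local Open Scope classical_set_scope.
Local Open Scope ring_scope.

(* The extreme value distribution function [G_xi]. *)
Definition gev (R : realType) (xi z : R) : R :=
  if xi == 0 then expR (- expR (- z))
  else if 0 < 1 + xi * z then expR (- ((1 + xi * z) `^ (- xi^-1)))
  else if 0 < xi then 0 else 1.

(* For [n >= 1] this is the maximum of the [n] values [X 0 w, ..., X n.-1 w];
   the seed [X 0 w] of the iteration is already one of them.  The value at
   [n = 0] is irrelevant. *)
Definition running_max (T : Type) (R : realType) (X : nat -> T -> R)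
    (n : nat) (w : T) : R :=
  \big[Num.max/X 0%N w]_(i < n) X i w.

(* The product rule for subfamilies is the case where some [B i] are [setT]. *)
Definition independent_RVs (d : measure_display) (T : measurableType d)
    (R : realType) (P : probability T R) (n : nat)
    (X : 'I_n -> {RV P >-> R}) : Prop :=
  forall B : 'I_n -> set R, (forall i, measurable (B i)) ->
    P (\bigcap_(i in [set: 'I_n]) (X i @^-1` B i)) =
    (\prod_(i < n) P (X i @^-1` B i))%E.

(* [X 0, ..., X n.-1] are i.i.d. under [P] with distribution function [F]. *)
Definition iid_cdf (d : measure_display) (T : measurableType d) (R : realType)
    (P : probability T R) (F : R -> R) (n : nat)
    (X : nat -> {RV P >-> R}) : Prop :=
  independent_RVs (fun i : 'I_n => X i) /\
  forall (i : 'I_n) (x : R), cdf (X i) x = (F x)%:E.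

(* The library type [cumulativeBounded 0 1] is that of the nondecreasing
   right-continuous functions with limits [0] at [-oo] and [1] at [+oo].  The
   law of the maximum depends only on [F] and [n], not on the space carrying
   the sample, so the convergence is asked for every i.i.d. sample. *)
Definition in_max_domain (R : realType) (F : cumulativeBounded (0 : R) (1 : R))
    (G : R -> R) (a b : nat -> R) : Prop :=
  (forall n, (0 < n)%N -> 0 < a n) /\
  forall (d : measure_display) (T : measurableType d) (P : probability T R)
      (Y : nat -> {RV P >-> R}),
    (forall n, iid_cdf F n Y) ->
    forall z : R,
      P [set w | (running_max Y n w - b n) / a n <= z] @[n --> \oo]
        --> (G z)%:E.

(* [P( . | C = k)], i.e. [A |-> P (A `&` [C = k]) / P [C = k]].  It is only
   meaningful when [P [C = k] != 0]; otherwise [mnormalize] falls back on its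
   last argument. *)
Definition cond_prob_eq (d : measure_display) (T : measurableType d)
    (R : realType) (P : probability T R) (C : {RV P >-> nat}) (k : nat) :
    probability T R :=
  mnormalize (mrestr P (measurable_funPTI C (I : measurable [set k]))) P.

(* [\sum_(k = 1)^K I(C = k) v_k], evaluated at the outcome [w]. *)
Definition select (T : Type) (R : realType) (C : T -> nat) (K : nat)
    (v : nat -> R) (w : T) : R :=
  \sum_(1 <= k < K.+1) \1_(C @^-1` [set k]) w * v k.

(* Main.v *)
(* The events [C = k] partition the sample space, and on [C = k] the normalized
   selected maximum is that of the [k]-th sample.  Hence its distribution
   function is the sum over [k] of [P [C = k]] times the distribution function
   of the latter under [P( . | C = k)], and [F k] being in the domain of
   attraction is applied on that conditional probability space. *)
Require Import Defs.
From mathcomp Require Import all_boot all_order all_algebra.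
From mathcomp Require Import all_classical all_reals all_analysis.
From mathcomp Require Import measurable_realfun.

Set Implicit Arguments.
Unset Strict Implicit.
Unset Printing Implicit Defensive.

Import Order.TTheory GRing.Theory Num.Theory.
Import numFieldNormedType.Exports.

Local Open Scope classical_set_scope.
Local Open Scope ring_scope.

(** As [C w] lies in the range of summation, exactly one indicator is nonzero at [w]. *)
Lemma select_mem (T : Type) (R : realType) (C : T -> nat) (K : nat)
    (v : nat -> R) (w : T) :
  (1 <= C w <= K)%N -> select C K v w = v (C w).
Proof.
move=> Cw; rewrite /select (bigD1_seq (C w)) ?iota_uniq ?mem_index_iota//=.
rewrite indicE mem_set// mul1r big1 ?addr0// => k kC.
by rewrite indicE memNset ?mul0r// => /= Ck; rewrite Ck eqxx in kC.
Qed.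

Lemma measurable_running_max (d : measure_display) (T : measurableType d)
    (R : realType) (X : nat -> {mfun T >-> R}) (n : nat) :
  measurable_fun setT (running_max X n).
Proof.
(* Passing to an arbitrary list of indices allows induction with the seed [X 0] kept fixed. *)
suff H s : measurable_fun setT
    (fun w => \big[Num.max/X 0%N w]_(i <- s) (X i w : R)).
  rewrite (_ : running_max X n =
    fun w => \big[Num.max/X 0%N w]_(i <- index_iota 0 n) X i w); first exact: H.
  by apply/funext => w; rewrite /running_max big_mkord.
elim: s => [|i s IH].
  by under eq_fun do rewrite big_nil; exact: measurable_funPT.
under eq_fun do rewrite big_cons.
by apply: measurable_maxr => //; exact: measurable_funPT.
Qed.

Lemma cond_prob_eqE (d : measure_display) (T : measurableType d)
    (R : realType) (P : probability T R) (C : {RV P >-> nat}) (k : nat)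
    (A : set T) :
  P [set w | C w = k] != 0%E ->
  P (A `&` [set w | C w = k]) =
    (P [set w | C w = k] * cond_prob_eq C k A)%E.
Proof.
move=> Ck0; have Ckfin : P (C @^-1` [set k]) \is a fin_num.
  exact: fin_num_measure (measurable_funPTI C (I : measurable [set k])).
rewrite /cond_prob_eq /= /mnormalize /= /mrestr setTI.
have -> : [set w | C w = k] = C @^-1` [set k] by [].
(* [mnormalize] falls back on [P] when the total mass, here that of [C = k], is zero or infinite.
   The hypothesis excludes the first case, finiteness of [P] the second. *)
rewrite (negbTE Ck0) /=.
case: ifPn => [/eqP Cky|_]; first by rewrite Cky in Ckfin.
rewrite muleCA -{1}(fineK Ckfin) -EFinM divff ?mule1//.
by rewrite -eqe fineK.
Qed.

Theorem mainTheorem1 (R : realType) (d : measure_display)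
    (T : measurableType d) (P : probability T R) (K : nat)
    (C : {RV P >-> nat}) (hC : forall w, (1 <= C w <= K)%N)
    (F : nat -> cumulativeBounded (0 : R) (1 : R)) (xi : nat -> R)
    (a b : nat -> nat -> R)
    (hF : forall k, (1 <= k <= K)%N ->
      in_max_domain (F k) (gev (xi k)) (a k) (b k))
    (X : nat -> nat -> {mfun T >-> R})
    (hX : forall k n, (1 <= k <= K)%N -> P [set w | C w = k] != 0%E ->
      iid_cdf (P := cond_prob_eq C k) (F k) n (X k)) :
  let M n w := select C K (fun k => running_max (X k) n w) w in
  let A n w := select C K (fun k => a k n) w in
  let B n w := select C K (fun k => b k n) w in
  forall z : R,
    P [set w | (M n w - B n w) / A n w <= z] @[n --> \oo] -->
    (\sum_(1 <= k < K.+1) P [set w | C w = k] * (gev (xi k) z)%:E)%E.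
Proof.
move=> M A B z.
pose E k n := [set w | (running_max (X k) n w - b k n) / a k n <= z].
pose S k := [set w | C w = k].
have mS k : measurable (S k) := measurable_funPTI C (I : measurable [set k]).
have mE k n : measurable (E k n).
  rewrite -[E k n]setTI.
  pose g w : R := (running_max (X k) n w - b k n) / a k n.
  have mg : measurable_fun setT g.
    apply: measurable_funM => //; apply: measurable_funB => //.
    exact: measurable_running_max.
  have -> : E k n = g @^-1` `]-oo, z]
    by apply/seteqP; split => w /=; rewrite in_itv.
  exact: mg.
have decomp n : P [set w | (M n w - B n w) / A n w <= z] =
    (\sum_(1 <= k < K.+1) P (E k n `&` S k))%E.
  (* The events are reindexed from 0, as finite additivity is stated over [i < K] while [C] takes
     values from 1 to [K]. *)
  have mES i : measurable (E i.+1 n `&` S i.+1) by exact: measurableI.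
  have tES : trivIset setT (fun i => E i.+1 n `&` S i.+1).
    by move=> i j _ _ [w [[_ Ci] [_ Cj]]]; apply: succn_inj; rewrite -Ci -Cj.
  have -> : [set w | (M n w - B n w) / A n w <= z] =
      \bigcup_(i < K) (E i.+1 n `&` S i.+1).
    (* At each [w] all three selections pick the same index [C w], so the quotient is the one that
       defines [E (C w) n]. *)
    apply/seteqP; split => w /=; rewrite /M /A /B !select_mem//.
      move: (hC w); case Cw: (C w) => [|i]// iK Ew.
      exists i; first exact: iK.
      by split; [exact: Ew|exact: Cw].
    by move=> [i _ [Ew Cw]]; rewrite Cw.
  rewrite bigcup_mkord; apply: etrans (measure_bigsetU P mES tES K) _.
  by rewrite big_add1 big_mkord.
have lim_joint k : (1 <= k <= K)%N ->
    P (E k n `&` S k) @[n --> \oo] --> (P (S k) * (gev (xi k) z)%:E)%E.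
  (* If [C = k] is null, [hX] gives nothing about the sample, but the joint probabilities and the
     proposed limit all vanish. *)
  move=> kK; have [Sk0|Sk0] := eqVneq (P (S k)) 0%E.
    rewrite Sk0 mul0e (_ : (fun n => _) = cst 0%E); first exact: cvg_cst.
    apply/funext => n; apply: (subset_measure0 _ _ _ Sk0) => //.
    exact: measurableI.
  rewrite (_ : (fun n => _) = fun n => (P (S k) * cond_prob_eq C k (E k n))%E);
    last by apply/funext => n; exact: cond_prob_eqE.
  apply: cvgeZl; first exact: fin_num_measure.
  by apply: (hF k kK).2 => n; exact: hX.
(* [big_nat_cond] keeps the bounds on [k] as a side condition, which [lim_joint] requires. *)
under eq_fun do rewrite decomp big_nat_cond.
rewrite big_nat_cond; apply: cvg_nnesum => k.
  (* Nonnegative terms let the limit pass through a finite sum of extended reals. *)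
  by move=> _; apply: nearW => n; exact: measure_ge0.
by rewrite andbT; exact: lim_joint.
Qed.
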